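(* Consider input-output data $(U,Y)$ with data matrices $Y_-\in\mathbb{R}^{p\times N}$, $U_-\in\mathbb{R}^{m\times N}$, $Z_-\in\mathbb{R}^{n\times N}$, instrumental data $R_-\in\mathbb{R}^{M\times N}$ and noise-bound matrices $Q_{11},Q_{12},Q_{22}$ with $Q_{22}\prec 0$, and a performance output $z(t)=C_z\zeta(t)+D_zu(t)$, as in the context. Let $\gamma>0$. The data $(U,Y)$ are informative for common $\mathcal{H}_\infty$ control (by an output-feedback controller $C(q^{-1})u(t)=D(q^{-1})y(t)$) with performance $\gamma$ if there exist $L\in\mathbb{R}^{m\times n}$, $P\in\mathbb{R}^{n\times n}$ with $P\succ0$, $\alpha\ge0$ and $\beta>0$ such that, with $F:=C_zP+D_zL$, $$\begin{bmatrix} P-\gamma^{-1}H_zH_z^\top-\beta I & 0 & 0 & J_1P+J_2L & 0 \\ 0 & 0 & 0 & P & 0 \\ 0 & 0 & 0 & L & 0 \\ P^\top J_1^\top+L^\top J_2^\top & P & L^\top & P & F^\top \\ 0 & 0 & 0 & F & \gamma I \end{bmatrix}-\alpha\begin{bmatrix} I & H_zY_-R_-^\top \\ 0 & -Z_-R_-^\top \\ 0 & -U_-R_-^\top \\ 0 & 0 \\ 0 & 0 \end{bmatrix}Q_e\begin{bmatrix} I & H_zY_-R_-^\top \\ 0 & -Z_-R_-^\top \\ 0 & -U_-R_-^\top \\ 0 & 0 \\ 0 & 0 \end{bmatrix}^\top\succeq0$$ and $$\begin{bmatrix} P & F^\top \\ F & \gamma I \end{bmatrix}\succ0 .$$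
   Context: All matrices are real; $\succ,\succeq,\prec$ refer to symmetric matrices in the (semi)definite order. Zero and identity blocks have the dimensions dictated by conformity. System and data. Fix integers $p,m,l,N,M\ge1$ and let $n:=(p+m)l$. The system class is $A(q^{-1})y(t)=B(q^{-1})u(t)+e(t)$, $y(t)\in\mathbb{R}^p$, $u(t)\in\mathbb{R}^m$, noise $e(t)\in\mathbb{R}^p$, $q^{-1}$ the delay operator, $A(\xi)=I+A_1\xi+\cdots+A_l\xi^l$, $B(\xi)=B_0+B_1\xi+\cdots+B_l\xi^l$. Put $\bar A:=[-A_1\ \cdots\ -A_l]\in\mathbb{R}^{p\times pl}$, $\bar B:=[B_1\ \cdots\ B_l]\in\mathbb{R}^{p\times ml}$, and $\zeta(t):=\operatorname{col}(y(t-1),\dots,y(t-l),u(t-1),\dots,u(t-l))\in\mathbb{R}^n$. Data matrices: $Z_-=[\zeta(0)\cdots\zeta(N-1)]$, $Y_-=[y(0)\cdots y(N-1)]$, $U_-=[u(0)\cdots u(N-1)]$; the noise matrix $E_-=[e(0)\cdots e(N-1)]$ is unknown. The data equation is $$Y_-=[\bar A\ \ \bar B]Z_-+B_0U_-+E_-.\quad\text{(D)}$$ Noise bound. A given signal $r(t)\in\mathbb{R}^M$ defines $R_-=[r(0)\cdots r(N-1)]$. With a given symmetric matrix $Q=\begin{bmatrix} Q_{11} & Q_{12} \\ Q_{12}^\top & Q_{22} \end{bmatrix}$, $Q_{11}\in\mathbb{R}^{p\times p}$, $Q_{22}\in\mathbb{R}^{M\times M}$, $Q_{22}\prec0$, the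 noise is known to satisfy $$\begin{bmatrix} I \\ R_-E_-^\top \end{bmatrix}^\top Q\begin{bmatrix} I \\ R_-E_-^\top \end{bmatrix}\succeq0.\quad\text{(N)}$$ State-space matrices. Partition the $n$ rows into blocks of sizes $p,\ p(l-1),\ m,\ m(l-1)$. Let $H_z=\operatorname{col}(I_p,0,0,0)\in\mathbb{R}^{n\times p}$, $J_2=\operatorname{col}(0,0,I_m,0)\in\mathbb{R}^{n\times m}$, and let $J_1\in\mathbb{R}^{n\times n}$, with column blocks of sizes $p(l-1),p,m(l-1),m$, be $$J_1=\begin{bmatrix} 0 & 0 & 0 & 0 \\ I_{p(l-1)} & 0 & 0 & 0 \\ 0 & 0 & 0 & 0 \\ 0 & 0 & I_{m(l-1)} & 0 \end{bmatrix}.$$ Let $Q_e:=\begin{bmatrix} H_zQ_{11}H_z^\top & H_zQ_{12} \\ Q_{12}^\top H_z^\top & Q_{22} \end{bmatrix}$. Compatible systems. $\Sigma^{RQ}_{(U,Y)}$ is the set of all pairs $(\Lambda_e,B_e)=\left(\begin{bmatrix} \bar A & \bar B \\ 0 & 0 \end{bmatrix},\begin{bmatrix} B_0 \\ 0 \end{bmatrix}\right)\in\mathbb{R}^{n\times n}\times\mathbb{R}^{n\times m}$ (with $\bar A\in\mathbb{R}^{p\times pl}$, $\bar B\in\mathbb{R}^{p\times ml}$, $B_0\in\mathbb{R}^{p\times m}$) for which there exists $E_-\in\mathbb{R}^{p\times N}$ such that (D) and (N) hold. Further $\bar\Sigma^{RQ}_{(U,Y)}:=\{(\Lambda_e+J_1,B_e+J_2)\mid(\Lambda_e,B_e)\in\Sigma^{RQ}_{(U,Y)}\}$;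 its elements are denoted $(A_z,B_z)$, and $\zeta(t+1)=A_z\zeta(t)+B_zu(t)+H_ze(t)$. Controller. The output-feedback controller is $C(q^{-1})u(t)=D(q^{-1})y(t)$ with $C(\xi)=I+C_1\xi+\cdots+C_l\xi^l$ and $D(\xi)=D_1\xi+\cdots+D_l\xi^l$; equivalently $u(t)=K\zeta(t)$ with $K=[D_1\cdots D_l\ \ -C_1\cdots-C_l]\in\mathbb{R}^{m\times n}$. Performance. $C_z$ and $D_z$ are given matrices with $n$ and $m$ columns, respectively, and the same number of rows; the performance output is $z(t)=C_z\zeta(t)+D_zu(t)$. Write $A_K:=A_z+B_zK$ and $C_K:=C_z+D_zK$. Informativity. The data $(U,Y)$ are informative for common $\mathcal{H}_\infty$ control by an output-feedback controller with performance $\gamma$ if there exist $K\in\mathbb{R}^{m\times n}$ and a matrix $X\succ0$ such that for every $(A_z,B_z)\in\bar\Sigma^{RQ}_{(U,Y)}$ $$\begin{bmatrix} X & 0 & A_K^\top X & C_K^\top \\ 0 & \gamma I & H_z^\top X & 0 \\ X A_K & X H_z & X & 0 \\ C_K & 0 & 0 & \gamma I \end{bmatrix}\succ0 .$$ *)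

(* Defs.v *)
From mathcomp Require Import all_boot all_order all_algebra.
From mathcomp Require Import classical_sets reals.

Set Implicit Arguments.
Unset Strict Implicit.
Unset Printing Implicit Defensive.

Import Order.TTheory GRing.Theory Num.Theory.
Local Open Scope classical_set_scope.
Local Open Scope ring_scope.

Notation row4 a b c d := (row_mx a (row_mx b (row_mx c d))).
Notation row5 a b c d e := (row_mx a (row_mx b (row_mx c (row_mx d e)))).
Notation col4 a b c d := (col_mx a (col_mx b (col_mx c d))).
Notation col5 a b c d e := (col_mx a (col_mx b (col_mx c (col_mx d e)))).

Definition posdefmx (R : realType) (k : nat) (S : 'M[R]_k) : Prop :=
  S^T = S /\ forall x : 'cV[R]_k, x != 0 -> 0 < (x^T *m S *m x) 0 0.

Definition possemidefmx (R : realType) (k : nat) (S : 'M[R]_k) : Prop :=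
  S^T = S /\ forall x : 'cV[R]_k, 0 <= (x^T *m S *m x) 0 0.

Definition negdefmx (R : realType) (k : nat) (S : 'M[R]_k) : Prop :=
  S^T = S /\ forall x : 'cV[R]_k, x != 0 -> (x^T *m S *m x) 0 0 < 0.

(* The size p * l is kept in the split form p + p * (l - 1), and n = (p + m) * l
   in the form (p + p * (l - 1)) + (m + m * (l - 1)), so that block matrices can
   be written without casts; see ndimE.  This is only meaningful for 0 < l. *)
Definition lagdim (p l : nat) : nat := p + l.-1 * p.
Definition ndim (p m l : nat) : nat := lagdim p l + lagdim m l.

Lemma ndimE (p m l : nat) : (0 < l)%N -> ndim p m l = ((p + m) * l)%N.
Proof.
by case: l => // l _; rewrite /ndim /lagdim /= -!mulSn -mulnDr mulnC.
Qed.

Fixpoint past (R : realType) (d k : nat) (x : int -> 'cV[R]_d) (t : int) :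
    'cV[R]_(k * d) :=
  match k with
  | 0 => 0
  | k'.+1 => col_mx (x (t - 1)) (past k' x (t - 1))
  end.

(* col (x (t - 1), ..., x (t - l)) for 0 < l, see lagsE *)
Definition lags (R : realType) (d l : nat) (x : int -> 'cV[R]_d) (t : int) :
    'cV[R]_(lagdim d l) :=
  col_mx (x (t - 1)) (past l.-1 x (t - 1)).

Lemma lagsE (R : realType) (d k : nat) (x : int -> 'cV[R]_d) (t : int) :
  lags k.+1 x t = past k.+1 x t.
Proof. by []. Qed.

Definition zeta (R : realType) (p m l : nat)
    (y : int -> 'cV[R]_p) (u : int -> 'cV[R]_m) (t : int) :
    'cV[R]_(ndim p m l) :=
  col_mx (lags l y t) (lags l u t).

Definition datamx (R : realType) (d N : nat) (x : int -> 'cV[R]_d) :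
    'M[R]_(d, N) :=
  \matrix_(i < d, t < N) x (t : nat)%:Z i 0.

Definition Hz (R : realType) (p m l : nat) : 'M[R]_(ndim p m l, p) :=
  col_mx (col_mx 1%:M 0) (col_mx 0 0).

Definition J2 (R : realType) (p m l : nat) : 'M[R]_(ndim p m l, m) :=
  col_mx (col_mx 0 0) (col_mx 1%:M 0).

(* [0 0; I 0] with row blocks of sizes d, d * (l - 1) and column blocks of sizes d * (l - 1), d. *)
Definition shiftmx (R : realType) (d l : nat) : 'M[R]_(lagdim d l) :=
  castmx (erefl, addnC (l.-1 * d) d)
    (block_mx (0 : 'M_(d, l.-1 * d)) (0 : 'M_(d, d))
              (1%:M : 'M_(l.-1 * d)) (0 : 'M_(l.-1 * d, d))).

Definition J1 (R : realType) (p m l : nat) : 'M[R]_(ndim p m l) :=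
  block_mx (shiftmx R p l) 0 0 (shiftmx R m l).

Definition Qext (R : realType) (p m l M : nat)
    (Q11 : 'M[R]_p) (Q12 : 'M[R]_(p, M)) (Q22 : 'M[R]_M) :
    'M[R]_(ndim p m l + M) :=
  block_mx (Hz R p m l *m Q11 *m (Hz R p m l)^T) (Hz R p m l *m Q12)
           (Q12^T *m (Hz R p m l)^T)             Q22.

Definition noise_bound (R : realType) (p M N : nat)
    (Q : 'M[R]_(p + M)) (Rm : 'M[R]_(M, N)) (E : 'M[R]_(p, N)) : Prop :=
  possemidefmx ((col_mx 1%:M (Rm *m E^T))^T *m Q *m col_mx 1%:M (Rm *m E^T)).

Definition Sigma (R : realType) (p m l N M : nat)
    (y : int -> 'cV[R]_p) (u : int -> 'cV[R]_m) (r : int -> 'cV[R]_M)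
    (Q : 'M[R]_(p + M)) :
    set ('M[R]_(ndim p m l) * 'M[R]_(ndim p m l, m)) :=
  [set LB | exists (Abar : 'M[R]_(p, lagdim p l)) (Bbar : 'M[R]_(p, lagdim m l))
                   (B0 : 'M[R]_(p, m)) (E : 'M[R]_(p, N)),
    [/\ LB.1 = col_mx (col_mx (row_mx Abar Bbar) 0) 0,
        LB.2 = col_mx (col_mx B0 0) 0,
        datamx N y = row_mx Abar Bbar *m datamx N (zeta l y u)
                     + B0 *m datamx N u + E
      & noise_bound Q (datamx N r) E]].

Definition Sigmabar (R : realType) (p m l N M : nat)
    (y : int -> 'cV[R]_p) (u : int -> 'cV[R]_m) (r : int -> 'cV[R]_M)
    (Q : 'M[R]_(p + M)) :
    set ('M[R]_(ndim p m l) * 'M[R]_(ndim p m l, m)) :=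
  [set (LB.1 + J1 R p m l, LB.2 + J2 R p m l) | LB in Sigma N y u r Q].

(* In informative_Hinf, K = [D_1 ... D_l  -C_1 ... -C_l] collects the
   coefficients of the controller C(q^-1) u(t) = D(q^-1) y(t). *)
Definition informative_Hinf (R : realType) (p m l N M q : nat)
    (y : int -> 'cV[R]_p) (u : int -> 'cV[R]_m) (r : int -> 'cV[R]_M)
    (Q : 'M[R]_(p + M))
    (Cz : 'M[R]_(q, ndim p m l)) (Dz : 'M[R]_(q, m)) (gamma : R) : Prop :=
  exists (K : 'M[R]_(m, ndim p m l)) (X : 'M[R]_(ndim p m l)),
    posdefmx X /\
    forall (Az : 'M[R]_(ndim p m l)) (Bz : 'M[R]_(ndim p m l, m)),
      Sigmabar N y u r Q (Az, Bz) ->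
      let AK := Az + Bz *m K in
      let CK := Cz + Dz *m K in
      let H := Hz R p m l in
      posdefmx
        (col4 (row4 X         0         (AK^T *m X) CK^T)
              (row4 0         gamma%:M  (H^T *m X)  0)
              (row4 (X *m AK) (X *m H)  X           0)
              (row4 CK        0         0           gamma%:M)).

(* Main.v *)
Require Import Defs.
From mathcomp Require Import all_boot all_order all_algebra.
From mathcomp Require Import classical_sets reals.
From mathcomp Require Import ring lra.

Set Implicit Arguments.
Unset Strict Implicit.
Unset Printing Implicit Defensive.

Import Order.TTheory GRing.Theory Num.Theory.
Local Open Scope ring_scope.

(* Restrict the quadratic form of the first LMI to the vectors
   (x, Lambda^T x, B^T x, X a, b), where X := P^-1 and (Lambda, B) is compatible
   with the data.  There T^T w = (x, R E^T H^T x), so the subtracted term is alpha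
   times the noise form at H^T x, hence nonnegative, and with K := L X one is left
   with
     x^T (P - H H^T / gamma) x + 2 x^T A_K a + a^T X a + 2 b^T C_K a
       + gamma |b|^2 >= beta |x|^2.
   The quadratic form of the performance LMI at (v1, v2, v3, v4) is the left-hand
   side at x = X v3, a = v1, b = v4, plus gamma |v2 + H^T x / gamma|^2.  So it is
   nonnegative; if it vanishes then x = 0 and v2 = 0, and the second LMI
   forces v1 = 0 and v4 = 0. *)

Section BilinearForm.
Variable R : comPzRingType.

(** Rectangular [A] is allowed so that each off-diagonal block has its own form; block inequalities
    then become scalar identities within reach of [ring] and [lra]. *)
Definition bform (a b : nat) (A : 'M[R]_(a, b)) (x : 'cV[R]_a) (y : 'cV[R]_b) : R :=
  (x^T *m A *m y) 0 0.

Lemma bform_tr (a b : nat) (A : 'M[R]_(a, b)) x y :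
  bform A^T x y = bform A y x.
Proof.
have -> : bform A y x = (y^T *m A *m x)^T 0 0 by rewrite mxE.
by rewrite !trmx_mul trmxK mulmxA.
Qed.

Lemma bform_col (a1 a2 b : nat) (A1 : 'M[R]_(a1, b)) (A2 : 'M[R]_(a2, b)) x1 x2 y :
  bform (col_mx A1 A2) (col_mx x1 x2) y = bform A1 x1 y + bform A2 x2 y.
Proof. by rewrite /bform tr_col_mx mul_row_col mulmxDl mxE. Qed.

Lemma bform_row (a b1 b2 : nat) (A1 : 'M[R]_(a, b1)) (A2 : 'M[R]_(a, b2)) x y1 y2 :
  bform (row_mx A1 A2) x (col_mx y1 y2) = bform A1 x y1 + bform A2 x y2.
Proof. by rewrite /bform mul_mx_row mul_row_col mxE. Qed.

Lemma bform0 (a b : nat) x y : bform (0 : 'M[R]_(a, b)) x y = 0.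
Proof. by rewrite /bform mulmx0 mul0mx mxE. Qed.

Lemma bformD (a b : nat) (A B : 'M[R]_(a, b)) x y :
  bform (A + B) x y = bform A x y + bform B x y.
Proof. by rewrite /bform mulmxDr mulmxDl mxE. Qed.

Lemma bformN (a b : nat) (A : 'M[R]_(a, b)) x y : bform (- A) x y = - bform A x y.
Proof. by rewrite /bform mulmxN mulNmx mxE. Qed.

Lemma bformZ (a b : nat) c (A : 'M[R]_(a, b)) x y :
  bform (c *: A) x y = c * bform A x y.
Proof. by rewrite /bform -scalemxAr -scalemxAl mxE. Qed.

Lemma bform_scalar (a : nat) c x y : bform (c%:M : 'M[R]_a) x y = c * bform 1%:M x y.
Proof. by rewrite -bformZ scalemx1. Qed.

Lemma bform_mull (a b c : nat) (A : 'M[R]_(a, b)) (B : 'M[R]_(b, c)) x y :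
  bform (A *m B) x y = bform B (A^T *m x) y.
Proof. by rewrite /bform trmx_mul trmxK !mulmxA. Qed.

Lemma bform_mulr (a b c : nat) (A : 'M[R]_(a, b)) (B : 'M[R]_(b, c)) x y :
  bform (A *m B) x y = bform A x (B *m y).
Proof. by rewrite /bform !mulmxA. Qed.

Lemma bformDl (a b : nat) (A : 'M[R]_(a, b)) x1 x2 y :
  bform A (x1 + x2) y = bform A x1 y + bform A x2 y.
Proof. by rewrite /bform linearD /= !mulmxDl mxE. Qed.

Lemma bformDr (a b : nat) (A : 'M[R]_(a, b)) x y1 y2 :
  bform A x (y1 + y2) = bform A x y1 + bform A x y2.
Proof. by rewrite /bform mulmxDr mxE. Qed.

Lemma bformZl (a b : nat) (A : 'M[R]_(a, b)) c x y :
  bform A (c *: x) y = c * bform A x y.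
Proof. by rewrite /bform linearZ /= -!scalemxAl mxE. Qed.

Lemma bformZr (a b : nat) (A : 'M[R]_(a, b)) c x y :
  bform A x (c *: y) = c * bform A x y.
Proof. by rewrite /bform -scalemxAr mxE. Qed.

Lemma bform1C (a : nat) (x y : 'cV[R]_a) : bform 1%:M x y = bform 1%:M y x.
Proof. by rewrite -bform_tr trmx1. Qed.

Lemma bform_block (a1 a2 b1 b2 : nat) (A : 'M[R]_(a1, b1)) (B : 'M[R]_(a1, b2))
    (C : 'M[R]_(a2, b1)) (D : 'M[R]_(a2, b2)) x1 x2 y1 y2 :
  bform (block_mx A B C D) (col_mx x1 x2) (col_mx y1 y2)
  = bform A x1 y1 + bform B x1 y2 + bform C x2 y1 + bform D x2 y2.
Proof. by rewrite /block_mx bform_col !bform_row addrA. Qed.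

(** Standard basis vectors recover the entries of [S]. Symmetry of a nested block matrix can thus be
    read off from its expanded form. *)
Lemma trmx_bform (k : nat) (S : 'M[R]_k) :
  (forall x y, bform S x y = bform S y x) -> S^T = S.
Proof.
move=> symS; apply/matrixP => i j; rewrite mxE.
have bform_delta i' j' : bform S (delta_mx i' 0) (delta_mx j' 0) = S i' j'.
  by rewrite /bform trmx_delta -rowE -colE !mxE.
by rewrite -!bform_delta symS.
Qed.

Definition bformE := (bform_col, bform_row, bform0, bformD, bformN, bformZ).

End BilinearForm.

Section Definiteness.
Variable R : realType.

Lemma bform1_ge0 (k : nat) (x : 'cV[R]_k) : 0 <= bform 1%:M x x.
Proof.
rewrite /bform mulmx1 mxE sumr_ge0 // => i _.
by rewrite mxE -expr2 sqr_ge0.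
Qed.

Lemma bform1_eq0 (k : nat) (x : 'cV[R]_k) : bform 1%:M x x = 0 -> x = 0.
Proof.
rewrite /bform mulmx1 mxE => /eqP; rewrite psumr_eq0; last first.
  by move=> i _; rewrite mxE -expr2 sqr_ge0.
move=> /allP sq0; apply/matrixP => i j; rewrite ord1 mxE.
by have := sq0 i (mem_index_enum i); rewrite /= mxE -expr2 sqrf_eq0 => /eqP.
Qed.

(** A nonzero row of the left kernel of [P^T], transposed, would be a nonzero vector killed by [P],
    where the form vanishes. *)
Lemma posdefmx_unit (k : nat) (P : 'M[R]_k) : posdefmx P -> P \in unitmx.
Proof.
move=> [_ posP]; rewrite -unitmx_tr -row_free_unit -kermx_eq0.
apply/eqP/row_matrixP => i; rewrite row0; apply/eqP; apply: contraT => nz.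
have := posP (row i (kermx P^T))^T; rewrite -[0]trmx0 (inj_eq trmx_inj) => /(_ nz).
have Px0 : P *m (row i (kermx P^T))^T = 0.
  by apply: trmx_inj; rewrite trmx_mul trmxK -row_mul mulmx_ker row0 trmx0.
by rewrite -mulmxA Px0 mulmx0 mxE ltxx.
Qed.

(** The form of [invmx P] at [x] is the form of [P] at [invmx P *m x]. *)
Lemma posdefmx_inv (k : nat) (P : 'M[R]_k) : posdefmx P -> posdefmx (invmx P).
Proof.
move=> pdP; have uP := posdefmx_unit pdP; case: pdP => symP posP.
have symX : (invmx P)^T = invmx P by rewrite trmx_inv symP.
split=> // x nzx.
have nzPx : invmx P *m x != 0.
  by apply: contraNneq nzx => Xx0; rewrite -(mulKVmx uP x) Xx0 mulmx0.
by have := posP _ nzPx; rewrite trmx_mul symX -!mulmxA mulKVmx ?mulmxA.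
Qed.

End Definiteness.

Theorem theorem2 (R : realType) (p m l N M q : nat)
  (hp : (0 < p)%N) (hm : (0 < m)%N) (hl : (0 < l)%N)
  (hN : (0 < N)%N) (hM : (0 < M)%N)
  (y : int -> 'cV[R]_p) (u : int -> 'cV[R]_m) (r : int -> 'cV[R]_M)
  (Q11 : 'M[R]_p) (Q12 : 'M[R]_(p, M)) (Q22 : 'M[R]_M)
  (hQ11 : Q11^T = Q11) (hQ22 : negdefmx Q22)
  (Cz : 'M[R]_(q, ndim p m l)) (Dz : 'M[R]_(q, m))
  (gamma : R) (hgamma : 0 < gamma) :
  (exists (L : 'M[R]_(m, ndim p m l)) (P : 'M[R]_(ndim p m l)) (alpha beta : R),
    let F := Cz *m P + Dz *m L in
    let H := Hz R p m l in
    let J1 := J1 R p m l in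
    let J2 := J2 R p m l in
    let Y := datamx N y in
    let U := datamx N u in
    let Z := datamx N (zeta l y u) in
    let Rm := datamx N r in
    let T := col5 (row_mx 1%:M (H *m Y *m Rm^T))
                  (row_mx 0    (- Z *m Rm^T))
                  (row_mx 0    (- U *m Rm^T))
                  (row_mx 0    (0 : 'M_(ndim p m l, M)))
                  (row_mx 0    (0 : 'M_(q, M))) in
    [/\ posdefmx P,
        0 <= alpha,
        0 < beta,
        possemidefmx
          (col5
            (row5 (P - gamma^-1 *: (H *m H^T) - beta%:M)
                      (0 : 'M_(_, ndim p m l)) (0 : 'M_(_, m))
                      (J1 *m P + J2 *m L)            0)
            (row5 0   0  0    P                      0)
            (row5 0   0  0    L                      0)
            (row5 (P^T *m J1^T + L^T *m J2^T)
                      P  L^T  P                      F^T)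
            (row5 0   0  0    F                      gamma%:M)
           - alpha *: (T *m Qext m l Q11 Q12 Q22 *m T^T))
      & posdefmx (block_mx P F^T F gamma%:M)]) ->
  informative_Hinf N y u r (block_mx Q11 Q12 Q12^T Q22) Cz Dz gamma.
Proof.
case=> L [P [alpha [beta]]] /=.
set F := Cz *m P + Dz *m L; set G := J1 R p m l *m P + J2 R p m l *m L.
set H := Hz R p m l.
set Y := datamx N y; set U := datamx N u; set Z := datamx N (zeta l y u).
set Rm := datamx N r; set S := (X in X - alpha *: _); set T := (X in X *m Qext _ _ _ _ _).
move=> [pdP alpha_ge0 beta_gt0 [_ psdS] [_ pdF]].
have uP := posdefmx_unit pdP.
have pdX := posdefmx_inv pdP; set X := invmx P in pdX.
have [symP _] := pdP; have [symX _] := pdX.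
(* The usual linearizing substitution: [K := L *m X] gives [K *m P = L], so [AK *m P] and [CK *m P]
   are affine in [P] and [L]. *)
exists (L *m X), X; split=> // Az Bz [[Lam B]] [Abar [Bbar [B0 [E]]]] [] /= defLam defB.
move=> defY noiseE [<- <-].
set AK := _ + _ *m _; set CK := Cz + _.
have AKP : AK *m P = Lam *m P + B *m L + G.
  rewrite /AK !mulmxDl -!mulmxA mulVmx // mulmx1.
  by rewrite /G !addrA; congr (_ + _); rewrite addrAC.
have CKP : CK *m P = F by rewrite /CK mulmxDl -!mulmxA mulVmx // mulmx1.
have GT : P^T *m (J1 R p m l)^T + L^T *m (J2 R p m l)^T = G^T.
  by rewrite linearD /= !trmx_mul.
(* Only the first block row of [Lam] and [B] is nonzero, so both factor through [H], and the data
   equation expresses the unknown noise by the data. *)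
have HE : H *m E = H *m Y - Lam *m Z - B *m U.
  have -> : Lam = H *m row_mx Abar Bbar.
    by rewrite defLam /H /Hz !mul_col_mx mul1mx !mul0mx col_mx0.
  have -> : B = H *m B0.
    by rewrite defB /H /Hz !mul_col_mx mul1mx !mul0mx col_mx0.
  by rewrite -!mulmxA -!mulmxBr /Y defY -[_ - _ - _]addrA -opprD addrC addKr.
have QextE : Qext m l Q11 Q12 Q22 =
    block_mx (H *m Q11 *m H^T) (H *m Q12) (Q12^T *m H^T) Q22 by [].
rewrite -/H.
have PX : P *m X = 1%:M := mulmxV uP.
clearbody H F G AK CK X.
have formX a : bform X a a = bform P (X *m a) (X *m a).
  by rewrite -bform_mulr PX -[in RHS]symX -bform_mull mulmx1.
have formAK x a : bform AK x a =
    bform P (Lam^T *m x) (X *m a) + bform L (B^T *m x) (X *m a) + bform G x (X *m a).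
  by rewrite -!bform_mull -!bformD -AKP -bform_mulr -mulmxA PX mulmx1.
have formCK b a : bform CK b a = bform F b (X *m a).
  by rewrite -CKP -bform_mulr -mulmxA PX mulmx1.
have formH x v : bform H x v = bform 1%:M (H^T *m x) v.
  by rewrite -bform_mull mulmx1.
have formS x a b : beta * bform 1%:M x x <=
    bform P x x - gamma^-1 * bform 1%:M (H^T *m x) (H^T *m x)
    + 2 * bform AK x a + bform X a a + 2 * bform CK b a + gamma * bform 1%:M b b.
  (* The second and third blocks assemble [(H *m E)^T *m x] in [T^T *m w]; the fourth is [X *m a]
     because [P *m X = 1]. *)
  pose w := col_mx x (col_mx (Lam^T *m x) (col_mx (B^T *m x) (col_mx (X *m a) b))).
  have Tw : T^T *m w = col_mx x (Rm *m E^T *m (H^T *m x)).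
    rewrite /T !tr_col_mx !tr_row_mx !mul_row_col !mul_col_mx !add_col_mx.
    rewrite trmx1 !trmx0 mul1mx !mul0mx !addr0; congr col_mx.
    have -> : Rm *m E^T *m (H^T *m x) = Rm *m ((H *m E)^T *m x).
      by rewrite trmx_mul !mulmxA.
    rewrite HE !mulNmx [(_ - B *m U)^T]linearB /= [(_ - Lam *m Z)^T]linearB /=.
    rewrite [(- (Z *m _))^T]linearN [(- (U *m _))^T]linearN /= !trmx_mul !trmxK.
    by rewrite !(mulmxDl, mulmxDr, mulNmx, mulmxN) !mulmxA !addrA.
  (* Moving the factors [H] of [Qext] onto [x] turns this into the noise-bound form at
     [H^T *m x]. *)
  have noise_ge0 : 0 <= bform (T *m Qext m l Q11 Q12 Q22 *m T^T) w w.
    rewrite bform_mulr bform_mull Tw QextE bform_block.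
    have := noiseE.2 (H^T *m x); rewrite -/(bform _ _ _) -/Rm.
    rewrite bform_mulr bform_mull trmxK mul_col_mx mul1mx bform_block.
    by rewrite !(bform_mulr _ H^T) !(bform_mull H).
  have := psdS w; rewrite -/(bform _ w w) bformD bformN bformZ.
  have -> : bform S w w = bform P x x - gamma^-1 * bform 1%:M (H^T *m x) (H^T *m x)
     - beta * bform 1%:M x x
    + 2 * bform AK x a + bform X a a + 2 * bform CK b a + gamma * bform 1%:M b b.
    (* Each cross term occurs in two mutually transposed blocks; both are brought to the same
       orientation so that [ring] can add them. *)
    rewrite /S GT /w !bformE !bform_tr -[bform P (X *m a) (Lam^T *m x)]bform_tr symP.
    rewrite formX formAK formCK (bform_scalar beta) (bform_scalar gamma).
    rewrite (bform_mulr H) formH.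
    ring.
  have := mulr_ge0 alpha_ge0 noise_ge0; rewrite -/T; lra.
have XAKT : AK^T *m X = (X *m AK)^T by rewrite trmx_mul symX.
have XHT : H^T *m X = (X *m H)^T by rewrite trmx_mul symX.
rewrite XAKT XHT; split.
  apply: trmx_bform => x z.
  rewrite -[x]vsubmxK -[dsubmx x]vsubmxK -[dsubmx (dsubmx x)]vsubmxK.
  rewrite -[z]vsubmxK -[dsubmx z]vsubmxK -[dsubmx (dsubmx z)]vsubmxK.
  rewrite !bformE !bform_tr !(bform_scalar gamma).
  rewrite -[bform X (usubmx x) _]bform_tr.
  rewrite -[bform X (usubmx (dsubmx (dsubmx x))) _]bform_tr symX.
  rewrite (bform1C (usubmx (dsubmx x))) (bform1C (dsubmx (dsubmx (dsubmx x)))).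
  ring.
move=> v; rewrite -/(bform _ v v).
rewrite -[v]vsubmxK -[dsubmx v]vsubmxK -[dsubmx (dsubmx v)]vsubmxK.
move: (usubmx v) (usubmx (dsubmx v)) (usubmx (dsubmx (dsubmx v)))
  (dsubmx (dsubmx (dsubmx v))) => v1 v2 v3 v4 {v}.
rewrite !bformE !bform_tr !(bform_scalar gamma) !(bform_mull X) symX (formX v3).
rewrite formH.
set x := X *m v3.
(* Completing the square in [v2] absorbs the cross term with [H] and produces the [gamma^-1] term of
   [formS]. *)
pose c := v2 + gamma^-1 *: (H^T *m x).
have sqc : gamma * bform 1%:M c c = gamma * bform 1%:M v2 v2
    + 2 * bform 1%:M (H^T *m x) v2 + gamma^-1 * bform 1%:M (H^T *m x) (H^T *m x).
  rewrite /c !(bformDl, bformDr, bformZl, bformZr) (bform1C v2).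
  by field; rewrite gt_eqF.
have beta_ge0 := mulr_ge0 (ltW beta_gt0) (bform1_ge0 x).
have gammac_ge0 := mulr_ge0 (ltW hgamma) (bform1_ge0 c).
have := formS x v1 v4.
set lhs := (X in _ -> _ -> 0 < X) => formSx.
have lhsE : lhs = bform P x x - gamma^-1 * bform 1%:M (H^T *m x) (H^T *m x)
    + 2 * bform AK x v1 + bform X v1 v1 + 2 * bform CK v4 v1
    + gamma * bform 1%:M v4 v4 + gamma * bform 1%:M c c.
  by rewrite sqc /lhs; ring.
(* By [formSx] and [lhsE], [beta] times the squared norm of [x] plus [gamma] times that of [c] is at
   most [lhs]. If [lhs <= 0], both nonnegative terms vanish. *)
apply: contraNT; rewrite -leNgt => lhs_le0.
have x0 : x = 0.
  apply: bform1_eq0; apply: (mulfI (lt0r_neq0 beta_gt0)); rewrite mulr0; lra.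
have c0 : c = 0.
  apply: bform1_eq0; apply: (mulfI (lt0r_neq0 hgamma)); rewrite mulr0; lra.
have v30 : v3 = 0 by rewrite -[v3]mul1mx -PX -mulmxA -/x x0 mulmx0.
have v20 : v2 = 0 by move: c0; rewrite /c x0 mulmx0 scaler0 addr0.
(* With [x = 0] and [c = 0], [lhs] is exactly the form of the second LMI at [(X *m v1, v4)]. This
   vector must therefore be zero, and then [v1 = P *m X *m v1 = 0]. *)
have [/eqP|nz] := eqVneq (col_mx (X *m v1) v4) 0.
  rewrite col_mx_eq0 => /andP[/eqP Xv1 /eqP ->].
  by rewrite v30 v20 -[v1]mul1mx -PX -mulmxA Xv1 mulmx0 !col_mx0.
have := pdF _ nz; rewrite -/(bform _ _ _) bform_block bform_tr bform_scalar.
rewrite -formX -formCK; move: lhs_le0.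
rewrite lhsE c0 x0 mulmx0 /bform !(trmx0, mul0mx) !mxE; lra.
Qed.
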